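(* Let $X=\{X_t\}_{t\ge 0}$ be a Markov chain with finite state space $S$ of size $n$, and let $x,y\in S$ be any two states. Then, for all integers $t>n$, $$\mathbf{P}_x(\tau(y)=t)\le \frac{n}{t},\qquad\text{whence}\qquad \mathbf{P}_x(\mathcal{S}_t)\le\frac{n^2}{t}.$$
   Context: Markov chains are in discrete time and time-homogeneous. $\mathbf{P}_x$ denotes the probability for the chain started at $X_0=x$. The hitting time is $\tau(y)=\min\{t\ge 0: X_t=y\}$ (with value $\infty$ if $y$ is never reached). $\mathcal{S}_t$ denotes the event that the state visited at time $t$ was not visited at any earlier time, i.e. $\mathcal{S}_t=\bigcup_{y\in S}\{\tau(y)=t\}$. *)

(* Defs.v *)
From HB Require Import structures.
From mathcomp Require Import all_boot all_order all_algebra.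
From mathcomp Require Import all_classical all_reals all_analysis.

Set Implicit Arguments.
Unset Strict Implicit.
Unset Printing Implicit Defensive.

Import Order.TTheory GRing.Theory Num.Theory.

Local Open Scope classical_set_scope.
Local Open Scope ring_scope.

Definition stochastic (R : realType) (S : finType) (p : S -> S -> R) : Prop :=
  (forall a b : S, 0 <= p a b) /\ (forall a : S, \sum_(b : S) p a b = 1).

(* Meaningful only when [P B != 0]. *)
Definition cond_prob (R : realType) (d : measure_display)
    (T : measurableType d) (P : probability T R) (A B : set T) : R :=
  fine (P (A `&` B)) / fine (P B).

Definition history (T : Type) (S : finType) (X : nat -> T -> S)
    (t : nat) (h : nat -> S) : set T :=
  [set w | forall i : nat, (i <= t)%N -> X i w = h i].

(* [S] carries the discrete sigma-algebra; being finite, it is enough to ask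
   that preimages of singletons be measurable. *)
Definition markov_chain (R : realType) (d : measure_display)
    (T : measurableType d) (P : probability T R) (S : finType)
    (p : S -> S -> R) (X : nat -> T -> S) : Prop :=
  [/\ stochastic p,
      forall (t : nat) (a : S), measurable [set w | X t w = a] &
      forall (t : nat) (h : nat -> S) (b : S),
        P (history X t h) != 0%E ->
        cond_prob P [set w | X t.+1 w = b] (history X t h) = p (h t) b].

Definition started_at (R : realType) (d : measure_display)
    (T : measurableType d) (P : probability T R) (S : finType)
    (X : nat -> T -> S) (x : S) : Prop :=
  P [set w | X 0%N w = x] = 1%E.

(* [None] stands for the value infinity. *)
Definition hitting_time (T : Type) (S : finType) (X : nat -> T -> S)
    (y : S) (w : T) : option nat :=
  match pselect (exists t : nat, X t w == y) with
  | left visited => Some (ex_minn visited)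
  | right _ => None
  end.

Definition new_state_event (T : Type) (S : finType) (X : nat -> T -> S)
    (t : nat) : set T :=
  \bigcup_(y in [set: S]) [set w | hitting_time X y w = Some t].

(* Main.v *)
(** Kill the chain on entering [y]: with [Q] the killed kernel and
    [v = p(., y)], the first entrance after time 0 occurs at time [s + 1] with
    probability [(Q^s v)(x)]. In terms of the resolvent [R = (1 - z Q)^-1],
    decomposing at the first visit to [a] gives
    [R(x,a) (R v)(a) <= R(a,a) (R v)(x)] coefficientwise in [z]. Summing over
    [a], the coefficient of [z^s] on the left is [(s + 1) (Q^s v)(x)], while on
    the right [Q^k(a,a) <= 1] and the entrance probabilities sum to at most 1,
    so that [(s + 1) (Q^s v)(x) <= |S|]. *)
Require Import Defs.
From mathcomp Require Import all_boot all_order all_algebra.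
From mathcomp Require Import all_classical all_reals all_analysis.

Import Order.TTheory GRing.Theory Num.Theory.

Local Open Scope classical_set_scope.
Local Open Scope ring_scope.

Set Implicit Arguments.
Unset Strict Implicit.
Unset Printing Implicit Defensive.

Section SubstochasticKernel.
Variables (R : realType) (S : finType) (Q : S -> S -> R).
Hypothesis Q_ge0 : forall a b, 0 <= Q a b.

(** The action of $Q^k$ on functions; the entry $Q^k(x,a)$ is obtained as
    [kernel_pow (unit_mass a) k x]. *)
Definition kernel_pow (v : S -> R) (k : nat) : S -> R :=
  iter k (fun u a => \sum_b Q a b * u b) v.

Lemma kernel_powS (v : S -> R) (k : nat) (a : S) :
  kernel_pow v k.+1 a = \sum_b Q a b * kernel_pow v k b.
Proof. by []. Qed.

Definition unit_mass (a b : S) : R := (b == a)%:R.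

Lemma kernel_pow_ge0 (v : S -> R) (k : nat) (a : S) :
  (forall b, 0 <= v b) -> 0 <= kernel_pow v k a.
Proof.
move=> v_ge0; elim: k a => [|k IHk] a; first exact: v_ge0.
by rewrite kernel_powS sumr_ge0 // => b _; rewrite mulr_ge0.
Qed.

Lemma unit_mass_ge0 (a b : S) : 0 <= unit_mass a b.
Proof. by rewrite /unit_mass ler0n. Qed.

Lemma sum_kernel_pow (v : S -> R) (k : nat) (x : S) :
  \sum_a kernel_pow (unit_mass a) k x * v a = kernel_pow v k x.
Proof.
elim: k x => [|k IHk] x.
  rewrite (bigD1 x) //= /unit_mass eqxx mul1r big1 ?addr0 // => a /negPf ax.
  by rewrite eq_sym ax mul0r.
rewrite kernel_powS.
under eq_bigr do rewrite kernel_powS mulr_suml.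
rewrite exchange_big /=; apply: eq_bigr => b _.
by rewrite -IHk mulr_sumr; apply: eq_bigr => a _; rewrite mulrA.
Qed.

(** An induction on [s], uniform in [x], stands in for the first-visit decomposition. At [x = a] the
    two sides coincide; otherwise one step from [x] is taken on both sides and the induction
    hypothesis is averaged with the weights [Q x b]. *)
Lemma convolution_visit_le (v : S -> R) (s : nat) (a x : S) :
    (forall b, 0 <= v b) ->
  \sum_(k < s.+1) kernel_pow (unit_mass a) k x * kernel_pow v (s - k) a <=
  \sum_(k < s.+1) kernel_pow (unit_mass a) k a * kernel_pow v (s - k) x.
Proof.
move=> v_ge0; elim: s x => [|s IHs] x; have [->//|xa] := eqVneq x a.
  by rewrite !big_ord1 /= /unit_mass (negPf xa) eqxx mul0r mul1r.
have last_ge0 : 0 <= kernel_pow (unit_mass a) s.+1 a * kernel_pow v 0 x.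
  by rewrite mulr_ge0 // kernel_pow_ge0 // => b; exact: unit_mass_ge0.
(* As [x] differs from [a], the term [k = 0] on the left vanishes; on the right the last term is
   dropped, being nonnegative. The remaining sums have equal length. *)
rewrite big_ord_recl [kernel_pow _ ord0 x]/= {1}/unit_mass (negPf xa) mul0r.
rewrite [leRHS]big_ord_recr subnn [leLHS]addrC lerD //.
under eq_bigr do rewrite lift0 subSS kernel_powS mulr_suml.
under [leRHS]eq_bigr => k _ do
  rewrite (subSn (leq_ord k)) kernel_powS mulr_sumr.
rewrite exchange_big [leRHS]exchange_big /=; apply: ler_sum => b _.
under eq_bigr do rewrite -mulrA.
under [leRHS]eq_bigr do rewrite mulrCA.
by rewrite -!mulr_sumr ler_wpM2l.
Qed.

Lemma kernel_pow_le1 (v : S -> R) (k : nat) (a : S) :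
    (forall b, \sum_c Q b c <= 1) -> (forall b, v b <= 1) ->
  kernel_pow v k a <= 1.
Proof.
move=> Q_le1 v_le1; elim: k a => [|k IHk] a; first exact: v_le1.
rewrite kernel_powS (le_trans _ (Q_le1 a)) // ler_sum // => b _.
by rewrite -[leRHS]mulr1 ler_wpM2l.
Qed.

(** The exits at distinct times are disjoint events. Analytically, split off the first step: exit at
    once with weight [v x], or move to [b] and have at most 1 left to collect. *)
Lemma sum_exit_le1 (v : S -> R) (s : nat) (x : S) :
    (forall b, v b + \sum_c Q b c <= 1) ->
  \sum_(k < s) kernel_pow v k x <= 1.
Proof.
move=> vQ_le1; elim: s x => [|s IHs] x; first by rewrite big_ord0 ler01.
rewrite big_ord_recl (le_trans _ (vQ_le1 x)) // lerD2l.
under eq_bigr do rewrite lift0 kernel_powS.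
rewrite exchange_big /=; apply: ler_sum => b _.
by rewrite -mulr_sumr -[leRHS]mulr1 ler_wpM2l.
Qed.

Lemma exit_time_le (v : S -> R) (s : nat) (x : S) :
    (forall b, 0 <= v b) -> (forall b, v b + \sum_c Q b c <= 1) ->
  kernel_pow v s x <= #|S|%:R / s.+1%:R.
Proof.
move=> v_ge0 vQ_le1.
have Q_le1 b : \sum_c Q b c <= 1 by rewrite (le_trans _ (vQ_le1 b)) ?lerDr.
rewrite ler_pdivlMr ?ltr0n //.
(* Each of the [s + 1] copies of $(Q^s v)(x)$ is cut at a different time [k], with [a] the state
   occupied at that time. *)
have -> : kernel_pow v s x * s.+1%:R = \sum_(k < s.+1) \sum_a
    kernel_pow (unit_mass a) k x * kernel_pow v (s - k) a.
  rewrite mulr_natr -[X in _ *+ X]card_ord -sumr_const.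
  apply: eq_bigr => k _; rewrite sum_kernel_pow.
  by rewrite /kernel_pow -iterD subnKC // -ltnS.
rewrite exchange_big /=.
(* It remains to see that each state [a] contributes at most 1. *)
rewrite -[X in _ <= X%:R]sum1_card natr_sum; apply: ler_sum => a _.
rewrite (le_trans (convolution_visit_le _ _ _ v_ge0)) //.
rewrite (le_trans _ (sum_exit_le1 s.+1 x vQ_le1)) //.
rewrite [leRHS](reindex_inj rev_ord_inj) /=; apply: ler_sum => k _.
rewrite subSS ler_piMl ?kernel_pow_ge0 // kernel_pow_le1 // => b.
by rewrite /unit_mass lern1 leq_b1.
Qed.

End SubstochasticKernel.

Lemma measure_cover_le (R : realType) (d : measure_display)
    (T : measurableType d) (mu : {measure set T -> \bar R}) (I : finType)
    (A : set T) (B : I -> set T) :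
    measurable A -> (forall i, measurable (B i)) ->
    A `<=` \bigcup_(i in [set: I]) B i ->
  (mu A <= \sum_i mu (B i))%E.
Proof.
move=> mA mB AB.
rewrite (le_trans (content_sub_fsum mu finite_finset (fun i _ => mB i) mA AB)) //.
rewrite (fsbigE (index_enum I)) ?index_enum_uniq // => [|i _].
  by under eq_bigl do rewrite in_setT.
by rewrite mem_index_enum.
Qed.

Section FirstPassage.
Variables (R : realType) (S : finType) (d : measure_display).
Variables (T : measurableType d) (P : probability T R).
Variables (p : S -> S -> R) (X : nat -> T -> S).
Hypothesis X_chain : markov_chain P p X.

(** Only the column of [y] is erased. The row of [y] survives, so every row sum together with the
    exit weight [p a y] is a full row sum of [p]. *)
Definition avoiding_kernel (y a b : S) : R := if b == y then 0 else p a b.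

(** Time [k] itself is left free, so the chain may sit at [y] then; the entrance takes [m] surviving
    steps and one exit step. *)
Definition first_passage_after (y : S) (k m : nat) : set T :=
  [set w | (forall i, (i < m)%N -> X (k + i).+1 w <> y) /\
           X (k + m).+1 w = y].

Lemma measurable_history k h : measurable (history X k h).
Proof.
have [_ mX _] := X_chain.
have -> : history X k h =
    \bigcap_(i in [set i | (i <= k)%N]) [set w | X i w = h i].
  by [].
by apply: bigcap_measurableType => i _; exact: mX.
Qed.

Lemma measurable_first_passage_after y k m :
  measurable (first_passage_after y k m).
Proof.
have [_ mX _] := X_chain.
apply: measurableI; last exact: mX.
apply: (@bigcap_measurableType _ _
  (fun i => ~` [set w | X (k + i).+1 w = y]) [set i | (i < m)%N]) => i _.
by apply: measurableC; exact: mX.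
Qed.

(** Product form of the Markov property. It also covers null histories, where both sides vanish. *)
Lemma history_step k h b :
  P (history X k h `&` [set w | X k.+1 w = b]) =
  (P (history X k h) * (p (h k) b)%:E)%E.
Proof.
have [_ mX Xmarkov] := X_chain.
have mh := measurable_history k h.
have mhb := measurableI _ _ mh (mX k.+1 b).
have [Ph0|Ph0] := eqVneq (P (history X k h)) 0%E.
  rewrite Ph0 mul0e; apply/eqP; rewrite eq_le measure_ge0 andbT -Ph0.
  by apply: le_measure; rewrite ?inE //; exact: subIsetl.
rewrite -(Xmarkov _ _ b Ph0) /cond_prob [in RHS]setIC.
rewrite -[LHS]fineK ?fin_num_measure //.
rewrite -[Y in (Y * _)%E]fineK ?fin_num_measure //.
by rewrite -EFinM mulrC divfK // fine_eq0 ?fin_num_measure.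
Qed.

(** Induction on [m] for all times and histories at once: split according to the state at time
    [k + 1] and absorb that state into the history. An upper bound suffices, so subadditivity
    replaces disjointness of the pieces. *)
Lemma history_first_passage_le y m k h :
  (P (history X k h `&` first_passage_after y k m) <=
   P (history X k h) *
     (kernel_pow (avoiding_kernel y) (p^~ y) m (h k))%:E)%E.
Proof.
have [[p_ge0 _] mX _] := X_chain.
elim: m k h => [|m IHm] k h.
  rewrite /= -history_step.
  apply: le_measure; rewrite ?inE; try apply: measurableI;
    do ?[exact: measurable_history|exact: measurable_first_passage_after
        |exact: mX].
  by move=> w [hw [_ +]]; rewrite addn0; split.
pose h' b i := if i == k.+1 then b else h i.
(* The empty piece at [y] matches the zero entry of [avoiding_kernel]: with [m + 1] surviving steps,
   [y] cannot occur at time [k + 1]. *)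
pose A b := if b == y then set0
  else history X k.+1 (h' b) `&` first_passage_after y k.+1 m.
have mA b : measurable (A b).
  rewrite /A; case: ifP => // _; apply: measurableI.
    exact: measurable_history.
  exact: measurable_first_passage_after.
have historyS b : history X k.+1 (h' b) =
    history X k h `&` [set w | X k.+1 w = b].
  apply/seteqP; split=> [w hw|w [hw Xb] i].
    split; last by rewrite /= hw // /h' eqxx.
    by move=> i ik; rewrite hw ?leqW // /h' ltn_eqF.
  by rewrite leq_eqVlt /h' => /predU1P[->|/[!ltnS] ik];
    rewrite ?eqxx // ltn_eqF // hw.
rewrite (le_trans (measure_cover_le P _ mA _)) //.
- apply: measurableI; first exact: measurable_history.
  exact: measurable_first_passage_after.
- move=> w [hw [avoid hit]]; exists (X k.+1 w) => //.
  rewrite /A; case: eqP => [Xy|_].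
    by have := avoid 0%N isT; rewrite addn0.
  split; first by rewrite historyS.
  split=> [i im|]; last by rewrite addSnnS.
  by rewrite addSnnS; exact: avoid.
have kernel_ge0 b : 0 <= kernel_pow (avoiding_kernel y) (p^~ y) m b.
  by apply: kernel_pow_ge0 => // a c; rewrite /avoiding_kernel; case: ifP.
rewrite kernel_powS -sumEFin ge0_sume_distrr; last first.
  by move=> b _; rewrite lee_fin mulr_ge0 // /avoiding_kernel; case: ifP.
apply: lee_sum => b _; rewrite /A /avoiding_kernel.
case: ifP => _; first by rewrite measure0 mul0r mule0.
rewrite (le_trans (IHm _ _)) // historyS history_step /h' eqxx.
by rewrite EFinM muleA.
Qed.

Lemma hitting_time_eqP y w t :
  hitting_time X y w = Some t <->
  (forall i, (i < t)%N -> X i w <> y) /\ X t w = y.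
Proof.
rewrite /hitting_time; case: pselect => [visited|never]; last first.
  by split=> // -[_ Xt]; case: never; exists t; apply/eqP.
case: ex_minnP => m /eqP Xm min_m; split=> [[<-]|[avoid Xt]].
  by split=> // i im /eqP/min_m; rewrite leqNgt im.
congr Some; apply/eqP; rewrite eqn_leq min_m ?Xt ?eqxx //= leqNgt.
by apply/negP => /avoid.
Qed.

Lemma measurable_hitting_time y t :
  measurable [set w | hitting_time X y w = Some t].
Proof.
have [_ mX _] := X_chain.
have -> : [set w | hitting_time X y w = Some t] =
    (\bigcap_(i in [set i | (i < t)%N]) ~` [set w | X i w = y]) `&`
    [set w | X t w = y].
  by apply/seteqP; split=> w /hitting_time_eqP.
apply: measurableI; last exact: mX.
by apply: bigcap_measurableType => i _; apply: measurableC; exact: mX.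
Qed.

Lemma hitting_time_le x y t :
    started_at P X x ->
  (P [set w | hitting_time X y w = Some t.+1] <=
   (#|S|%:R / t.+1%:R)%:E)%E.
Proof.
move=> X_start; have [[p_ge0 p_sum] mX _] := X_chain.
have history0 : history X 0 (fun=> x) = [set w | X 0%N w = x].
  by apply/seteqP; split=> [w|w Xw i]; [exact|rewrite leqn0 => /eqP ->].
have P_not_start : P (~` [set w | X 0%N w = x]) = 0%E.
  by rewrite probability_setC // X_start subee.
have start_le := history_first_passage_le y t 0 (fun=> x).
rewrite history0 X_start mul1e in start_le.
pose B := [set w | X 0%N w = x] `&` first_passage_after y 0 t.
have mB : measurable B.
  by apply: measurableI => //; exact: measurable_first_passage_after.
(* The chain starts at [x] only almost surely; the null set of other starts is adjoined to make the
   inclusion hold pointwise. *)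
rewrite (@le_trans _ _ (P (B `|` ~` [set w | X 0%N w = x]))) //.
  apply: le_measure; rewrite ?inE.
  - exact: measurable_hitting_time.
  - by apply: measurableU => //; exact: measurableC.
  move=> w /hitting_time_eqP[avoid hit].
  have [Xw|] := pselect (X 0%N w = x); [left; split=> //|by right].
  by split=> // i it; exact: avoid.
rewrite measureU0 //; last exact: measurableC.
rewrite (le_trans start_le) // lee_fin.
apply: exit_time_le => // [a b|b].
  by rewrite /avoiding_kernel; case: ifP.
(* Exit weight and killed row recombine into row [b] of the stochastic kernel, of total mass 1. *)
rewrite -(p_sum b) [leRHS](bigD1 y) //= lerD2l [leLHS](bigD1 y) //=.
by rewrite /avoiding_kernel eqxx add0r; apply: ler_sum => c /negPf ->.
Qed.

End FirstPassage.

Theorem proposition1p1 (R : realType) (S : finType) (n : nat)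
    (card_S : #|S| = n) (d : measure_display) (T : measurableType d)
    (P_x : probability T R) (p : S -> S -> R) (X : nat -> T -> S) (x y : S)
    (X_chain : markov_chain P_x p X) (X_start : started_at P_x X x) (t : nat)
    (lt_n_t : (n < t)%N) :
  (P_x [set w | hitting_time X y w = Some t] <= (n%:R / t%:R)%:E)%E /\
  (P_x (new_state_event X t) <= (n%:R ^+ 2 / t%:R)%:E)%E.
Proof.
case: t lt_n_t => // t _; rewrite -card_S.
split; first exact: (hitting_time_le X_chain _ _ X_start).
have mtau z := measurable_hitting_time X_chain z t.+1.
have mS : measurable (new_state_event X t.+1).
  exact: fin_bigcup_measurable.
(* Union bound over the [n] states that can be the new one. *)
rewrite (le_trans (measure_cover_le P_x mS mtau _)) //.
rewrite (le_trans (lee_sum _ (fun z _ => hitting_time_le X_chain z t X_start))) //.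
rewrite sumEFin lee_fin sumr_const.
by rewrite -[leLHS]mulr_natl expr2 -mulrA.
Qed.
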